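(* Let $(G,X^* )$ be a contracting self-similar action with limit $G$-space $\mathcal{X}_G$, measure $\mu$ on $\mathcal{X}_G$, and tile $\mathcal{T}$. Every point $x\in\mathcal{X}_G$ is covered by at least $\mu(\mathcal{T})$ tiles. The set $\dot{\mathcal{X}}_G$ of all points $x\in\mathcal{X}_G$ which are covered by exactly $\mu(\mathcal{T})$ tiles is open and dense in $\mathcal{X}_G$, and its complement has $\mu$-measure $0$.
   Context: Let $X$ be a finite nonempty set, $X^*$ the set of finite words over $X$, and $X^{-\omega}$ the space of left-infinite sequences $\ldots x_2x_1$, $x_i\in X$, with the product topology. A faithful (left) action of a group $G$ on $X^*$ is self-similar if for every $g\in G$, $x\in X$ there exist $h\in G$, $y\in X$ such that $g(xw)=y\,h(w)$ for all $w\in X^*$; then $h$ is denoted $g|_x$, and $g|_{x_1\ldots x_n}=g|_{x_1}|_{x_2}\cdots|_{x_n}$. The action is contracting if there is a finite set $\mathcal{N}\subset G$ such that for every $g\in G$ there is $k$ with $g|_v\in\mathcal{N}$ for all words $v$ of length $\ge k$. Two elements $\ldots x_2x_1\cdot g$ and $\ldots y_2y_1\cdot h$ of $X^{-\omega}\times G$ ($G$ discrete) are asymptotically equivalent if there are a finite set $K\subset G$ and $g_n\in K$, $n\ge1$, with $g_n(x_n\ldots x_1)=y_n\ldots y_1$ and $g_n|_{x_n\ldots x_1}\cdot g=h$ for all $n\ge 1$. The limit $G$-space $\mathcal{X}_G$ is the quotient topological space of $X^{-\omega}\times G$ by this relation; $G$ acts on it from the right by multiplication on the $G$-coordinate. The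 tile $\mathcal{T}$ is the image of $X^{-\omega}\times\{1\}$ in $\mathcal{X}_G$; the tiles are the sets $\mathcal{T}\cdot g$, $g\in G$, and the number of tiles covering a point $x$ is the number of $g\in G$ with $x\in\mathcal{T}\cdot g$. The measure $\mu$ on $\mathcal{X}_G$ is the push-forward, under the quotient map, of the product of the uniform Bernoulli measure on $X^{-\omega}$ (each letter has weight $1/|X|$) and the counting measure on $G$. *)

(* Defs.v *)
From HB Require Import structures.
From mathcomp Require Import all_boot all_order all_algebra.
From mathcomp Require Import all_classical all_reals all_analysis.

Set Implicit Arguments.
Unset Strict Implicit.
Unset Printing Implicit Defensive.

Import Order.TTheory GRing.Theory Num.Theory.

Local Open Scope classical_set_scope.
Local Open Scope quotient_scope.
Local Open Scope group_scope.

(* Nonempty finite alphabets. The distinguished letter only witnesses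
   nonemptiness: mathcomp-analysis requires measurable spaces to be pointed. *)
#[short(type="pfinType")]
HB.structure Definition PointedFinite := {T of Finite T & Pointed T}.

Section SelfSimilarActions.
Variables (X : finType) (G : groupType).

Record selfsimilar_action := SelfSimilarAction {
  act :> G -> seq X -> seq X;
  act1 : forall w, act 1 w = w;
  actM : forall g h w, act (g * h) w = act g (act h w);
  act_faithful : forall g h, (forall w, act g w = act h w) -> g = h;
  act_selfsimilar : forall g x,
    exists h, exists y, forall w, act g (x :: w) = y :: act h w }.

Variable S : selfsimilar_action.

(* The element g|_x, unique by faithfulness. *)
Definition letter_section (g : G) (x : X) : G :=
  xget 1 [set h | exists y, forall w, S g (x :: w) = y :: S h w].

Definition section (g : G) (v : seq X) : G := foldl letter_section g v.

Definition contracting : Prop :=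
  exists2 N : set G, finite_set N &
    forall g, exists k, forall v, (k <= size v)%N -> N (section g v).

Lemma act_cons g x : exists y, forall w,
  S g (x :: w) = y :: S (letter_section g x) w.
Proof.
have [h Hh] := act_selfsimilar S g x.
exact: (@xgetPex _ 1 [set h | exists y, forall w, S g (x :: w) = y :: S h w]
  (ex_intro _ h Hh)).
Qed.

Lemma letter_sectionP g x y h :
  (forall w, S g (x :: w) = y :: S h w) -> letter_section g x = h.
Proof.
move=> H; have [z Hz] := act_cons g x.
by apply: (@act_faithful S) => w; have := Hz w; rewrite H => -[_ ->].
Qed.

Lemma act_nil g : S g [::] = [::].
Proof.
case E : (S g [::]) => [//|x w].
have [y Hy] := act_cons g^-1 x.
by have := actM S g^-1 g [::]; rewrite mulVg act1 E Hy.
Qed.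

Lemma act_cat g v w : S g (v ++ w) = S g v ++ S (section g v) w.
Proof.
elim: v g => [|x v IH] g /=; first by rewrite act_nil.
by have [y Hy] := act_cons g x; rewrite !Hy IH.
Qed.

Lemma size_act g v : size (S g v) = size v.
Proof.
elim: v g => [|x v IH] g /=; first by rewrite act_nil.
by have [y ->] := act_cons g x; rewrite /= IH.
Qed.

Lemma section1 v : section 1 v = 1.
Proof.
elim: v => [//|x v IH] /=; rewrite (_ : letter_section 1 x = 1) //.
by apply: (@letter_sectionP 1 x x) => w; rewrite !act1.
Qed.

Lemma sectionM g h v : section (g * h) v = section g (S h v) * section h v.
Proof.
elim: v g h => [|x v IH] g h /=; first by rewrite act_nil.
have [y Hy] := act_cons h x; have [z Hz] := act_cons g y.
rewrite Hy /= -IH; congr (section _ v).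
by apply: (@letter_sectionP _ _ z) => w; rewrite !actM Hy Hz.
Qed.

End SelfSimilarActions.

(* A left-infinite sequence ...x_2x_1 is encoded by the function n |-> x_(n+1);
   its topology is the product of the discrete topologies and its sigma-algebra
   is the Borel one. *)
Definition leftinf (X : Type) : Type := nat -> X.

HB.instance Definition _ (X : choiceType) := Topological.copy (leftinf X)
  (prod_topology (fun _ : nat => discrete_topology X)).
HB.instance Definition _ (X : pointedType) :=
  isPointed.Build (leftinf X) (fun=> point).
HB.instance Definition _ (X : pointedType) :=
  Measurable.copy (leftinf X) (g_sigma_algebraType (@open (leftinf X))).

(* The word x_n...x_1. *)
Definition suffix_word (X : Type) (x : leftinf X) (n : nat) : seq X :=
  rev (mkseq x n).

Definition uniform_bernoulli (R : realType) (X : pfinType)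
    (P : probability (leftinf X) R) : Prop :=
  forall (n : nat) (x : leftinf X),
    P [set y | suffix_word y n = suffix_word x n] =
      ((#|X|%:R^-1 : R) ^+ n)%R%:E.

(* The group G with its discrete topology and its discrete sigma-algebra. *)
Definition discrete_group (G : groupType) : Type := G.

Section DiscreteGroup.
Variable G : groupType.
Local Notation dG := (discrete_group G).
HB.instance Definition _ := Group.on dG.
HB.instance Definition _ := isPointed.Build dG 1.
HB.instance Definition _ := DiscreteTopology.copy dG (discrete_topology G).
HB.instance Definition _ := @isMeasurable.Build default_measure_display dG
  (@discrete_measurable dG) (@discrete_measurable0 dG)
  (@discrete_measurableC dG) (@discrete_measurableU dG).
End DiscreteGroup.

Section LimitSpace.
Variables (X : pfinType) (G : groupType) (S : selfsimilar_action X G).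

Local Notation XG := (leftinf X * discrete_group G)%type.

Definition asymptotic (p q : XG) : Prop :=
  exists2 K : set G, finite_set K & exists gs : nat -> G,
    forall n, (1 <= n)%N ->
      [/\ K (gs n),
          S (gs n) (suffix_word p.1 n) = suffix_word q.1 n &
          section S (gs n) (suffix_word p.1 n) * p.2 = q.2].

Lemma asymptotic_refl p : asymptotic p p.
Proof.
exists [set 1]; first exact: finite_set1.
by exists (fun=> 1) => n _; split; rewrite ?act1 ?section1 ?mul1g.
Qed.

Lemma asymptotic_sym p q : asymptotic p q -> asymptotic q p.
Proof.
move=> [K fK [gs Hgs]]; exists [set k^-1 | k in K]; first exact: finite_image.
exists (fun n => (gs n)^-1) => n n1; have [Kg Eg sg] := Hgs n n1; split.
- by exists (gs n).
- by rewrite -Eg -actM mulVg act1.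
- by rewrite -sg mulgA -Eg -sectionM mulVg section1 mul1g.
Qed.

Lemma asymptotic_trans q p r :
  asymptotic p q -> asymptotic q r -> asymptotic p r.
Proof.
move=> [K fK [gs Hgs]] [L fL [hs Hhs]].
exists [set l * k | l in L & k in K]; first exact: finite_image2.
exists (fun n => hs n * gs n) => n n1.
have [Kg Eg sg] := Hgs n n1; have [Lh Eh sh] := Hhs n n1; split.
- by exists (hs n) => //; exists (gs n).
- by rewrite actM Eg.
- by rewrite sectionM -mulgA sg Eg.
Qed.

Definition asymptotic_rel : rel XG := fun p q => `[< asymptotic p q >].

Lemma asymptotic_rel_is_equiv : equiv_class_of asymptotic_rel.
Proof.
split.
- by move=> p; apply/asboolP; exact: asymptotic_refl.
- by move=> p q; apply/asboolP/asboolP; exact: asymptotic_sym.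
- move=> q p r /asboolP pq /asboolP qr; apply/asboolP.
  exact: asymptotic_trans pq qr.
Qed.

Canonical asymptotic_equiv := EquivRelPack asymptotic_rel_is_equiv.

Definition limit_space : Type :=
  quotient_topology {eq_quot asymptotic_equiv}.

HB.instance Definition _ := Quotient.on limit_space.
HB.instance Definition _ := Topological.on limit_space.
HB.instance Definition _ :=
  isPointed.Build limit_space (\pi_limit_space point).
HB.instance Definition _ :=
  Measurable.copy limit_space (g_sigma_algebraType (@open limit_space)).

Definition limit_proj (p : XG) : limit_space := \pi_limit_space p.

Lemma limit_projP p q : limit_proj p = limit_proj q <-> asymptotic p q.
Proof.
rewrite /limit_proj; split=> [/eqmodP/asboolP //|pq].
by apply/eqmodP/asboolP.
Qed.

Definition limit_act (a : limit_space) (g : G) : limit_space :=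
  limit_proj ((repr a).1, ((repr a).2 : G) * g).

Lemma limit_act_proj x (h g : G) :
  limit_act (limit_proj (x, h)) g = limit_proj (x, h * g).
Proof.
apply/limit_projP; have /limit_projP : limit_proj (repr (limit_proj (x, h))) =
  limit_proj (x, h) by rewrite /limit_proj reprK.
move=> [K fK [gs Hgs]]; exists K => //; exists gs => n n1 /=.
by have [Kg Eg sg] := Hgs n n1; split => //=; rewrite mulgA sg.
Qed.

Definition tile : set limit_space := [set limit_proj (x, 1) | x in setT].

Definition tile_translate (g : G) : set limit_space := limit_act^~ g @` tile.

Definition covering_number (R : realType) (a : limit_space) : \bar R :=
  counting [set g : discrete_group G | tile_translate g a].

(* The set-function m1 \x^ m2 is the product measure for which only the first
   factor needs to be sigma-finite: A is mapped to the integral over m2 of the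
   m1-measures of the sections of A. *)
Definition limit_measure (R : realType) (beta : probability (leftinf X) R) :
    set limit_space -> \bar R :=
  pushforward (beta \x^ counting)%E limit_proj.

End LimitSpace.

Arguments limit_proj {X G} S p.
Arguments limit_act {X G} S a g.
Arguments tile {X G} S.
Arguments tile_translate {X G} S g.
Arguments covering_number {X G} S R a.
Arguments limit_measure {X G} S {R} beta A.

(* Main.v *)
Require Import Defs.
From HB Require Import structures.
From mathcomp Require Import finmap.
From mathcomp Require Import all_boot all_order all_algebra.
From mathcomp Require Import all_classical all_reals all_analysis.
From mathcomp Require Import measurable_realfun.

(* Let N be a finite set of group elements, closed under sections, into which
   the sections of every element eventually fall. By Konig's lemma, a point
   represented by (x, g) lies in the tile T.h iff h g^-1 lies in the set N|_v of
   sections for every suffix v of x. The sets N|_v decrease, so the number of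
   tiles covering the point is the minimum over the suffixes v of x of
   rank(v) = |N|_v|, a function that is nonincreasing under extension of v on
   either side. If m is the minimal rank of a word, attained at w, then every
   covering number is at least m, with equality iff some suffix of x has rank m.
   This is an open condition; it is dense because w can be written to the left
   of any suffix, and of full measure because almost every x contains w.
   Integrating the number of covering tiles over x in X^{-omega} gives
   mu(T) = m. *)

Set Implicit Arguments.
Unset Strict Implicit.
Unset Printing Implicit Defensive.

Import Order.TTheory GRing.Theory Num.Theory.
Import numFieldNormedType.Exports.

Local Open Scope fset_scope.
Local Open Scope ereal_scope.
Local Open Scope group_scope.
Local Open Scope classical_set_scope.

(** * Suffixes of left-infinite sequences *)

Lemma suffix_wordS (X : Type) (x : leftinf X) n :
  suffix_word x n.+1 = x n :: suffix_word x n.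
Proof. by rewrite /suffix_word mkseqS rev_rcons. Qed.

Lemma size_suffix_word (X : Type) (x : leftinf X) n :
  size (suffix_word x n) = n.
Proof. by rewrite size_rev size_mkseq. Qed.

(** Index 0 holds the rightmost letter, so the suffix of length [n] is erased. *)
Definition leftinf_shift (X : Type) n (x : leftinf X) : leftinf X :=
  fun i => x (n + i)%N.

Lemma suffix_wordD (X : Type) (x : leftinf X) n k :
  suffix_word x (n + k) = suffix_word (leftinf_shift n x) k ++ suffix_word x n.
Proof.
elim: k => [|k IH]; first by rewrite addn0.
by rewrite addnS !suffix_wordS IH.
Qed.

(** * Finite section-closed absorbing sets *)

Section Nucleus.
Variables (X : finType) (G : groupType) (S : selfsimilar_action X G).

Lemma section_cat g v w : section S g (v ++ w) = section S (section S g v) w.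
Proof. exact: foldl_cat. Qed.

Lemma finite_bounded_words k : finite_set [set v : seq X | (size v < k)%N].
Proof.
apply: (@sub_finite_set _ _
  [set val (tagged t) | t in [set: {i : 'I_k & i.-tuple X}]]).
  move=> v /= vk; exists (Tagged (fun i : 'I_k => i.-tuple X)
    (in_tuple v : (Ordinal vk).-tuple X)) => //.
by apply: finite_image; exact: finite_finset.
Qed.

(* The nucleus of the literature is the smallest such set. *)
Definition is_nucleus (N : {fset G}) :=
  (forall g v, g \in N -> section S g v \in N) /\
  (forall g, exists k, forall v, (k <= size v)%N -> section S g v \in N).

(** All sections of elements of the given contracting set form a finite set: long words lead back
    into the given set, and there are finitely many short words. *)
Lemma nucleus_exists : contracting S -> exists N, is_nucleus N.
Proof.
move=> [N fN absN].
pose M := (\bigcup_(g in N) range (section S g))%classic.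
have fM : finite_set M.
  apply: bigcup_finite => // g Ng; have [k kN] := absN g.
  apply: (@sub_finite_set _ _
    (N `|` [set section S g v | v in [set v | (size v < k)%N]])).
    move=> _ [v _ <-]; have [vk|kv] := ltnP (size v) k; last by left; exact: kN.
    by right; exists v.
  by rewrite finite_setU; split=> //; apply/finite_image/finite_bounded_words.
exists (fset_set M); split=> g.
  move=> v; rewrite !in_fset_set// !inE => -[h Nh [u _ <-]].
  by exists h => //; exists (u ++ v); rewrite ?section_cat.
have [k kN] := absN g; exists k => v /kN Nv.
by rewrite in_fset_set// inE; exists (section S g v) => //; exists [::].
Qed.

(** Meant for the finite set that bounds the elements g_n of an asymptotic equivalence: one length
    serves for all of them. *)
Lemma nucleus_uniform N (K : set G) : is_nucleus N -> finite_set K ->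
  exists k, forall g v, K g -> (k <= size v)%N -> section S g v \in N.
Proof.
move=> [_ absN] /finite_seqP[s ->].
elim: s => [|h s [k IH]]; first by exists 0%N => g v; rewrite /= in_nil.
have [l hl] := absN h; exists (maxn k l) => g v /=.
rewrite in_cons geq_max => /orP[/eqP-> /andP[_ /hl]//|gs /andP[kv _]].
exact: IH.
Qed.

Definition nucleus_image (N : {fset G}) (w : seq X) : {fset G} :=
  [fset section S g w | g in N]%fset.

Lemma nucleus_imageP N w h :
  reflect (exists2 g, g \in N & section S g w = h) (h \in nucleus_image N w).
Proof.
by apply: (iffP (imfsetP _ _ _ _)) => -[g gN]; exists g.
Qed.

(** * Ranks of words and stable images along a sequence *)

Section Rank.
Variables (N : {fset G}) (nucN : is_nucleus N).

(** By closure of [N] under sections, g|_v is again in [N], and g|_{vw} is its section at w. *)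
Lemma nucleus_image_cat v w :
  (nucleus_image N (v ++ w) `<=` nucleus_image N w)%fset.
Proof.
apply/fsubsetP => _ /nucleus_imageP[g gN <-].
apply/nucleus_imageP; exists (section S g v); rewrite ?section_cat//.
exact: nucN.1.
Qed.

Definition rank w := #|` nucleus_image N w|.

Lemma rank_catr v w : (rank (v ++ w) <= rank w)%N.
Proof. exact/fsubset_leq_card/nucleus_image_cat. Qed.

(** N|_{vw} is the image of N|_v under the map h -> h|_w. *)
Lemma rank_catl v w : (rank (v ++ w) <= rank v)%N.
Proof.
rewrite /rank (_ : nucleus_image N (v ++ w) =
  [fset section S h w | h in nucleus_image N v]%fset).
  exact: leq_imfset_card.
apply/fsetP => h; apply/nucleus_imageP/imfsetP => [[g gN <-]|].
  exists (section S g v); last exact: section_cat.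
  by apply/nucleus_imageP; exists g.
by move=> [_ /= /nucleus_imageP[g gN <-] ->]; exists g; rewrite ?section_cat.
Qed.

Lemma min_rank_exists : exists w0, forall w, (rank w0 <= rank w)%N.
Proof.
have ex : exists r, `[< exists w, rank w = r >].
  by exists (rank [::]); apply/asboolP; exists [::].
case: (ex_minnP ex) => r /asboolP[w0 <-] minr; exists w0 => w.
by apply: minr; apply/asboolP; exists w.
Qed.

Definition stable_image (x : leftinf X) : {fset G} :=
  [fset h in N | `[< forall n, h \in nucleus_image N (suffix_word x n) >]]%fset.

Lemma stable_imageP x h :
  reflect (forall n, h \in nucleus_image N (suffix_word x n))
          (h \in stable_image x).
Proof.
rewrite !inE /=; apply: (iffP andP) => [[_ /asboolP]//|H].
split; last exact/asboolP.
(* The suffix of length 0 is empty, and sections at the empty word are trivial. *)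
by have /nucleus_imageP[g gN <-] := H 0%N.
Qed.

Lemma stable_image_sub x n :
  (stable_image x `<=` nucleus_image N (suffix_word x n))%fset.
Proof. by apply/fsubsetP => h /stable_imageP. Qed.

(** A decreasing sequence of finite sets is constant from any term of least cardinality on. *)
Lemma stable_imageE x :
  exists n, stable_image x = nucleus_image N (suffix_word x n).
Proof.
have ex : exists r, `[< exists n, rank (suffix_word x n) = r >].
  by exists (rank (suffix_word x 0)); apply/asboolP; exists 0%N.
case: (ex_minnP ex) => r /asboolP[n <-] minr; exists n.
apply/eqP; rewrite eqEfsubset stable_image_sub /=.
apply/fsubsetP => h hn; apply/stable_imageP => k.
have nkn : nucleus_image N (suffix_word x (n + k)) =
    nucleus_image N (suffix_word x n).
  apply/eqP; rewrite eqEfcard suffix_wordD nucleus_image_cat /= -suffix_wordD.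
  by apply: minr; apply/asboolP; exists (n + k)%N.
move: hn; rewrite -nkn addnC suffix_wordD.
exact/fsubsetP/nucleus_image_cat.
Qed.

(* The inductive step of Konig's lemma. *)
Lemma stable_image_lift x h : h \in stable_image x ->
  exists2 g, g \in stable_image (leftinf_shift 1 x) &
    letter_section S g (x 0%N) = h.
Proof.
(* At this [n] the image is already stable, so any g with g|_{x_{n+1}...x_1} = h yields a stable
   lift g|_{x_{n+1}...x_2}. *)
move=> /stable_imageP hx; have [n en] := stable_imageE (leftinf_shift 1 x).
have /nucleus_imageP[g gN gh] := hx (1 + n)%N.
exists (section S g (suffix_word (leftinf_shift 1 x) n)).
  by rewrite en; apply/nucleus_imageP; exists g.
by rewrite -gh suffix_wordD section_cat.
Qed.

End Rank.
End Nucleus.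

(** * Asymptotic equivalence, tiles and covering numbers in terms of stable images *)

Section Covering.
Variables (X : pfinType) (G : groupType) (S : selfsimilar_action X G).
Variables (N : {fset G}) (nucN : is_nucleus S N).

(** Forwards, the section of g_m at the letters of a long suffix beyond the n-th lies in [N], and
    its section at the remaining n letters is h g^-1. Backwards, repeated lifting of h g^-1 gives
    elements of [N] that serve as the g_n and determine y. *)
Lemma asymptotic_stable_image x (g h : G) :
  (exists y, asymptotic S (x, g) (y, h)) <-> (h * g^-1 \in stable_image S N x).
Proof.
split=> [[y [K fK [gs gsP]]]|].
  have [k kN] := nucleus_uniform nucN fK.
  apply/stable_imageP => n.
  (* The extra 1 keeps the length positive, as asymptotic equivalence demands, even for n = k =
     0. *)
  have [Kg _ /= sg] := gsP (n + k.+1)%N (ltn_addl _ (ltn0Sn _)).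
  apply/nucleus_imageP; exists (section S (gs (n + k.+1)%N)
    (suffix_word (leftinf_shift n x) k.+1)).
    by apply: kN => //; rewrite size_suffix_word.
  by rewrite -section_cat -suffix_wordD -sg mulgK.
move=> hx.
pose P n (s : G) := s \in stable_image S N (leftinf_shift n x).
have step n (s : {s | P n s}) :
    {t : {t | P n.+1 t} | letter_section S (val t) (x n) = val s}.
  case: s => s sP; apply/cid; have [t tP ts] := stable_image_lift nucN sP.
  have tP' : P n.+1 t.
    rewrite /P (_ : leftinf_shift n.+1 x =
      leftinf_shift 1 (leftinf_shift n x))//.
    by apply/funext => i; rewrite /leftinf_shift addnA addn1.
  by exists (exist _ t tP'); rewrite /= -ts /leftinf_shift addn0.
have P0 : P 0%N (h * g^-1) by [].
pose s := nat_rect (fun n => {s | P n s}) (exist (fun t => P 0%N t) _ P0)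
  (fun n s => sval (step n s)).
have sS n : letter_section S (val (s n.+1)) (x n) = val (s n).
  exact: svalP (step n (s n)).
(* The image of a one-letter word has one letter, so the default [point] is never taken. *)
pose y n := head point (S (val (s n.+1)) [:: x n]).
exists y, [set` N] => //; exists (fun n => val (s n)) => n _ /=.
have sn m : section S (val (s m)) (suffix_word x m) = h * g^-1.
  by elim: m => [//|m IH]; rewrite suffix_wordS /= sS.
split; last by rewrite sn mulgVK.
  by have /stable_imageP/(_ 0%N)/nucleus_imageP[t tN /= <-] := svalP (s n).
elim: n => [|n IH]; first by rewrite act_nil.
have [z Hz] := act_cons S (val (s n.+1)) (x n).
by rewrite !suffix_wordS Hz sS IH /y Hz.
Qed.

Lemma tile_translate_proj x g h :
  tile_translate S h (limit_proj S (x, g)) <->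
  h * g^-1 \in stable_image S N x.
Proof.
rewrite -asymptotic_stable_image; split.
  move=> [_ [y _ <-]]; rewrite limit_act_proj mul1g => /limit_projP yx.
  by exists y; apply: asymptotic_sym.
move=> [y xy]; exists (limit_proj S (y, 1)); first by exists y.
by rewrite limit_act_proj mul1g; apply/limit_projP/asymptotic_sym.
Qed.

Lemma tile_proj x g :
  tile S (limit_proj S (x, g)) <-> g^-1 \in stable_image S N x.
Proof.
rewrite -[g^-1]mul1g -tile_translate_proj; split.
  move=> [y _ yx]; exists (limit_proj S (y, 1)); first by exists y.
  by rewrite limit_act_proj mul1g.
by move=> [_ [y _ <-] <-]; exists y => //; rewrite limit_act_proj mul1g.
Qed.

(** Right multiplication by g is a bijection from the stable image onto the set of h whose tile
    contains the point. *)
Lemma covering_number_proj (R : realType) x g :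
  covering_number S R (limit_proj S (x, g)) =
  (#|` stable_image S N x|%:R : R)%R%:E%E.
Proof.
rewrite /covering_number.
have -> : [set h : discrete_group G | tile_translate S h (limit_proj S (x, g))]
    = [set` [fset (h * g : G) | h in stable_image S N x]%fset].
  apply/seteqP; split=> h /=; rewrite tile_translate_proj.
    by move=> hx; apply/imfsetP; exists (h * g^-1); rewrite ?mulgVK.
  by move=> /imfsetP[k kx ->]; rewrite mulgK.
rewrite /counting asboolT// set_fsetK card_imfset//; exact: mulIg.
Qed.

End Covering.

(* The letters beyond the length of w have the junk value point. *)
Definition leftinf_of (X : pointedType) (w : seq X) : leftinf X :=
  nth point (rev w).

Lemma suffix_word_leftinf_of (X : pointedType) (w : seq X) :
  suffix_word (leftinf_of w) (size w) = w.
Proof. by rewrite /suffix_word -size_rev mkseq_nth revK. Qed.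

(** * Topology and measurability of cylinders, and word counts *)

Section Cylinders.
Variable X : pfinType.

Lemma open_cylinder (x : leftinf X) n :
  open [set y : leftinf X | suffix_word y n = suffix_word x n].
Proof.
elim: n => [|n IH].
  rewrite (_ : [set y | _] = setT); first exact: openT.
  by apply/seteqP; split.
rewrite (_ : [set y | _] = ((fun y : leftinf X => y n) @^-1` [set x n])
  `&` [set y | suffix_word y n = suffix_word x n]); last first.
  apply/seteqP; split=> y /=; rewrite !suffix_wordS; first by case.
  by move=> [-> ->].
apply: openI => //.
apply: (@open_comp _ _ _ [set x n : discrete_topology X]).
  move=> y _.
  exact: (@proj_continuous nat (fun _ => discrete_topology X) n).
exact: discrete_open.
Qed.

Lemma open_suffix_word (P : seq X -> Prop) n :
  open [set y : leftinf X | P (suffix_word y n)].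
Proof.
rewrite (_ : [set y | _] = \bigcup_(x in [set x | P (suffix_word x n)])
  [set y | suffix_word y n = suffix_word x n]).
  by apply: bigcup_open => x _; exact: open_cylinder.
by apply/seteqP; split=> y /= => [Py|[x /= Px ->]//]; exists y.
Qed.

Lemma measurable_suffix_word (P : seq X -> Prop) n :
  measurable [set y : leftinf X | P (suffix_word y n)].
Proof. by apply: sub_sigma_algebra; exact: open_suffix_word. Qed.

Lemma measurable_forall_suffix_word (P : nat -> seq X -> Prop) :
  measurable [set y : leftinf X | forall n, P n (suffix_word y n)].
Proof.
rewrite (_ : [set y | _] = \bigcap_n [set y | P n (suffix_word y n)]).
  apply: bigcap_measurable => // n _; exact: (measurable_suffix_word (P n) n).
by apply/seteqP; split=> y /= Py => [n _|n]; exact: Py.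
Qed.

Lemma cvg_leftinf (u : nat -> leftinf X) (x : leftinf X) :
  (forall n i, (i < n)%N -> u n i = x i) -> u @ \oo --> x.
Proof.
(* The product topology is the supremum of the topologies induced by the coordinates, and coordinate
   i is constant from n = i + 1 on. *)
move=> ux; apply/cvg_sup => i U [/= _ [[V /= oV <- /= Vxi]]] /filterS; apply.
by exists i.+1 => // n /= ni; rewrite /preimage /= ux.
Qed.

Lemma cvg_leftinf_of_cat (w : nat -> seq X) (x : leftinf X) :
  (fun n => leftinf_of (w n ++ suffix_word x n)) @ \oo --> x.
Proof.
apply: cvg_leftinf => n i ni; rewrite /leftinf_of rev_cat /suffix_word revK.
by rewrite nth_cat size_mkseq ni nth_mkseq.
Qed.

(** [P] passes to prefixes and suffixes, so cutting after n letters turns each admissible word into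
    a pair of admissible words that determines it. *)
Lemma card_factorial_words (P : pred (seq X)) (n L : nat) :
  (forall u v, P (u ++ v) -> P u && P v) ->
  (#|[pred t : (n + L).-tuple X | P t]| <=
   #|[pred t : n.-tuple X | P t]| * #|[pred t : L.-tuple X | P t]|)%N.
Proof.
move=> Pcat.
rewrite -cardX; apply: leq_trans (leq_image_card
  (fun p : n.-tuple X * L.-tuple X => cat_tuple p.1 p.2) _).
apply: subset_leq_card; apply/fintype.subsetP => t; rewrite inE => Pt.
have st : size (take n t) == n by rewrite size_takel// size_tuple leq_addr.
have sd : size (drop n t) == L by rewrite size_drop size_tuple addKn.
move: Pt; rewrite -{1}(cat_take_drop n t) => /Pcat/andP[Pu Pv].
apply/fintype.imageP; exists (Tuple st, Tuple sd); first by rewrite !inE /= Pu.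
by apply/val_inj; rewrite /= cat_take_drop.
Qed.

Lemma card_factorial_words_exp (P : pred (seq X)) (L k : nat) :
  (forall u v, P (u ++ v) -> P u && P v) ->
  (#|[pred t : (k * L).-tuple X | P t]| <=
   #|[pred t : L.-tuple X | P t]| ^ k)%N.
Proof.
move=> Pcat; elim: k => [|k IH].
  by rewrite expn0; apply: leq_trans (max_card _) _; rewrite card_tuple expn0.
rewrite mulSn addnC expnSr; apply: leq_trans (card_factorial_words _ _ Pcat) _.
by rewrite leq_mul2r IH orbT.
Qed.

(** * Bernoulli measure of sets defined by suffixes *)

Section Bernoulli.
Variables (R : realType) (beta : probability (leftinf X) R).
Hypothesis beta_unif : uniform_bernoulli beta.

Lemma uniform_bernoulli_suffix (P : pred (seq X)) n :
  beta [set y | P (suffix_word y n)] =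
  ((#|[pred t : n.-tuple X | P t]|%:R : R) * (#|X|%:R^-1) ^+ n)%R%:E.
Proof.
have -> : [set y | P (suffix_word y n)] =
    \bigcup_(t in [set t : n.-tuple X | P t])
      [set y : leftinf X | suffix_word y n = t].
  apply/seteqP; split=> y /= => [Py|[t /= Pt ->]//].
  have sy : size (suffix_word y n) == n by rewrite size_suffix_word.
  by exists (Tuple sy).
rewrite measure_fin_bigcup//; last first.
- by move=> t _; exact: (measurable_suffix_word (fun v => v = t)).
- by move=> s t _ _ [y [/= ys yt]]; apply: val_inj; rewrite /= -ys -yt.
  exact: finite_finset.
rewrite (_ : [set t : n.-tuple X | P t] =
    [set` enum [pred t : n.-tuple X | P t]]); last first.
  by apply/seteqP; split=> t /=; rewrite mem_enum.
rewrite -fsbig_seq ?enum_uniq// big_enum/=.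
under eq_bigr => t _.
  (* [beta_unif] speaks of suffixes of sequences, so the word t is realised as one. *)
  have ht : val t = suffix_word (leftinf_of (val t)) n.
    by have := suffix_word_leftinf_of (val t); rewrite size_tuple.
  rewrite {1}ht beta_unif; over.
by rewrite sumEFin sumr_const mulr_natl.
Qed.

(** The word w is excluded, so at most a fraction r < 1 of the words of length |w| is admissible.
    Cutting a suffix of length k|w| into k blocks bounds the measure by r^k for every k. *)
Lemma factorial_words_null (P : pred (seq X)) w :
  (forall u v, P (u ++ v) -> P u && P v) -> ~~ P w ->
  beta [set y | forall n, P (suffix_word y n)] = 0%E.
Proof.
move=> Pcat Pw; set A := [set y | _]; set L := size w.
pose c := #|[pred t : L.-tuple X | P t]|; pose q := #|X|.
have mA : measurable A by exact: (measurable_forall_suffix_word (fun _ => P)).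
have q0 : (0 < q)%N by apply/fintype.card_gt0P; exists (@point X).
have cq : (c < q ^ L)%N.
  rewrite -card_tuple; apply/proper_card/properP.
  split; first exact/fintype.subsetP.
  by exists (in_tuple w).
pose r : R := (c%:R * (q%:R^-1) ^+ L)%R.
have qL0 : (0 < q%:R ^+ L :> R)%R by rewrite exprn_gt0// ltr0n.
have r0 : (0 <= r)%R by rewrite mulr_ge0// exprn_ge0// invr_ge0.
have r1 : (r < 1)%R.
  by rewrite /r exprVn ltr_pdivrMr// mul1r -natrX ltr_nat.
have Ar k : (beta A <= (r ^+ k)%:E)%E.
  apply: (@le_trans _ _ (beta [set y | P (suffix_word y (k * L)%N)])).
    apply: le_measure; rewrite ?inE//.
      exact: (measurable_suffix_word P).
    by move=> y /=; exact.
  rewrite uniform_bernoulli_suffix lee_fin exprMn -exprM mulnC.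
  rewrite ler_wpM2r// ?exprn_ge0 ?invr_ge0// -natrX ler_nat mulnC.
  exact: card_factorial_words_exp.
apply/eqP; rewrite eq_le measure_ge0 andbT.
have rk : (r ^+ k)%:E @[k --> \oo] --> (0%E : \bar R).
  by apply: cvg_EFin; [exact: nearW|apply: cvg_expr; rewrite ger0_norm].
rewrite -(cvg_lim _ rk)//; apply: lime_ge; first by apply/cvg_ex; exists 0%E.
exact: nearW.
Qed.

End Bernoulli.
End Cylinders.

(** f is the sum of its restrictions to the points of [A], and each point has counting measure 1. *)
Lemma integral_counting_fset (R : realType) (G : groupType)
    (A : {fset G}) (f : discrete_group G -> \bar R) :
  (forall h, 0 <= f h)%E -> (forall h, h \notin A -> f h = 0%E) ->
  (\int[counting]_h f h = \sum_(h <- A) f h)%E.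
Proof.
move=> f0 fA.
transitivity (\int[counting]_(h in [set: discrete_group G])
    (\sum_(k <- A) (f \_ [set k]) h))%E.
  apply: eq_integral => h _; have [hA|hA] := boolP (h \in A).
    rewrite (big_fsetD1 (h : G))//= patchT ?inE// big1_fset ?adde0// => k.
    by rewrite !inE => /andP[kh _] _; rewrite patchN//; apply/negP;
      rewrite inE/= => hk; rewrite hk eqxx in kh.
  rewrite fA// big1_fset// => k kA _.
  rewrite patchN//; apply/negP; rewrite inE/= => hk.
  by rewrite hk kA in hA.
rewrite ge0_integral_sum//; last first.
  by move=> k h _; rewrite /patch; case: ifP => _.
apply: eq_bigr => k _; rewrite -integral_mkcond.
rewrite (@eq_integral _ _ _ _ _ (cst (f k))); last first.
  by move=> h; rewrite inE/= => ->.
rewrite integral_cst//= /counting asboolT; last exact: finite_set1.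
by rewrite fset_set1 cardfs1 mule1.
Qed.

(** * Measure of the tile and the set of points with minimal covering number *)

Section Conclusion.
Variables (R : realType) (X : pfinType) (G : groupType).
Variables (S : selfsimilar_action X G) (beta : probability (leftinf X) R).
Hypothesis beta_unif : uniform_bernoulli beta.
Variables (N : {fset G}) (nucN : is_nucleus S N).
Variables (w0 : seq X) (w0_min : forall w, (rank S N w0 <= rank S N w)%N).

(** These sequences represent the exceptional points, whatever the group coordinate; see
    [regular_proj]. *)
Definition non_minimal : set (leftinf X) :=
  [set x | forall n, (rank S N w0 < rank S N (suffix_word x n))%N].

Lemma rank_min_le_stable x : (rank S N w0 <= #|` stable_image S N x|)%N.
Proof. by have [n ->] := stable_imageE nucN x; exact: w0_min. Qed.

(** The stable image has at least the minimal rank and sits inside the image along each suffix. *)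
Lemma card_stable_min x n : rank S N (suffix_word x n) = rank S N w0 ->
  #|` stable_image S N x| = rank S N w0.
Proof.
move=> xn; apply/eqP; rewrite eqn_leq rank_min_le_stable andbT -xn.
exact/fsubset_leq_card/stable_image_sub.
Qed.

Lemma non_minimalP x : non_minimal x <-> #|` stable_image S N x| <> rank S N w0.
Proof.
split=> [badx|xN n].
  have [n ->] := stable_imageE nucN x.
  by have := badx n; rewrite ltn_neqAle => /andP[/eqP/nesym].
by rewrite ltn_neqAle w0_min andbT eq_sym; apply/eqP => /card_stable_min.
Qed.

(** Monotonicity of the rank on both sides makes rank above the minimum a factorial condition, and
    [w0] violates it. *)
Lemma non_minimal_null : beta non_minimal = 0%E.
Proof.
apply: (factorial_words_null beta_unif (w := w0)
  (P := fun v => rank S N w0 < rank S N v)%N); last by rewrite ltnn.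
by move=> u v w0uv; rewrite !(leq_trans w0uv) ?rank_catl ?(rank_catr nucN).
Qed.

Lemma measurable_non_minimal : measurable non_minimal.
Proof.
exact: (measurable_forall_suffix_word
  (fun _ v => rank S N w0 < rank S N v)%N).
Qed.

Lemma measurable_mem_stable h : measurable [set x | h \in stable_image S N x].
Proof.
rewrite (_ : [set x | _] =
    [set x | forall n, h \in nucleus_image S N (suffix_word x n)]).
  exact: (measurable_forall_suffix_word (fun _ v => h \in nucleus_image S N v)).
by apply/seteqP; split=> x /= /stable_imageP.
Qed.

Lemma limit_measureE (A : set (limit_space S)) :
  limit_measure S beta A =
  (\int[counting]_(h in [set: discrete_group G])
    beta [set x | A (limit_proj S (x, h))])%E.
Proof.
by apply: eq_integral => h _ /=; congr (beta _); apply/seteqP; split=> x;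
  rewrite /ysection /= ?inE.
Qed.

Lemma stable_image_subN x h : h \in stable_image S N x -> h \in N.
Proof. by move=> /stable_imageP/(_ 0%N)/nucleus_imageP[g gN <-]. Qed.

Lemma sum_mem_stable x :
  (\sum_(k <- N) (k \in stable_image S N x) = #|` stable_image S N x|)%N.
Proof.
rewrite -big_mkcond/= sum1_count -size_filter; apply/perm_size/uniq_perm => //.
- by apply: filter_uniq; exact: fset_uniq.
- exact: fset_uniq.
by move=> k; rewrite mem_filter; apply/andb_idr/stable_image_subN.
Qed.

Lemma measure_tile :
  limit_measure S beta (tile S) = ((rank S N w0)%:R : R)%:E.
Proof.
rewrite limit_measureE.
(* The slice of the tile at h is empty unless h^-1 is in [N], which leaves a finite sum. *)
rewrite (integral_counting_fset (A := [fset k^-1 | k in N]%fset)).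
all: swap 1 3.
- move=> h /negP hN.
  have -> : [set x | tile S (limit_proj S (x, h))] = set0; last exact: measure0.
  rewrite -subset0 => x /(proj1 (tile_proj nucN x h)) /stable_image_subN hN'.
  by apply: hN; apply/imfsetP; exists h^-1 => //; rewrite invgK.
- by move=> h; exact: measure_ge0.
rewrite big_imfset//=; last by move=> ? ? _ _; exact: invg_inj.
pose E k := [set x | k \in stable_image S N x].
(* Exchanging sum and integral turns the sum of slice measures into the mean size of the stable
   image. *)
transitivity (\int[beta]_x \sum_(k <- N) (\1_(E k) x)%:E)%E.
  rewrite ge0_integral_sum//; last first.
    move=> k; apply/measurable_EFinP/measurable_indic.
    exact: measurable_mem_stable.
  apply: eq_bigr => k _.
  rewrite integral_indic//; last exact: measurable_mem_stable.
  rewrite setIT; congr (beta _).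
  by apply/seteqP; split=> x /=; rewrite (tile_proj nucN) invgK.
rewrite (@ae_eq_integral _ _ _ _ _ (cst (rank S N w0)%:R%:E))//.
- rewrite integral_cst// -[RHS]mule1; congr (_ * _)%E.
  exact: probability_setT.
- apply: emeasurable_sum => k.
  apply/measurable_EFinP/measurable_indic; exact: measurable_mem_stable.
- exists non_minimal; split.
    exact: measurable_non_minimal.
    exact: non_minimal_null.
  move=> x /= /not_implyP[_ xN]; apply/non_minimalP => xE; apply: xN.
  rewrite sumEFin -xE -sum_mem_stable natr_sum; congr (_%:E).
  by apply: eq_bigr => k _; rewrite indicE; congr (_%:R)%R; rewrite /E mem_setE.
Qed.

Lemma regular_proj x g :
  covering_number S R (limit_proj S (x, g)) = limit_measure S beta (tile S) <->
  ~ non_minimal x.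
Proof.
rewrite measure_tile (covering_number_proj nucN) non_minimalP; split.
  by move=> -[/eqP]; rewrite eqr_nat => /eqP xE /(_ xE).
by move=> /contrapT ->.
Qed.

Lemma limit_proj_surj (a : limit_space S) : exists x g, limit_proj S (x, g) = a.
Proof.
exists (repr a).1, (repr a).2; rewrite -surjective_pairing /limit_proj.
exact: reprK.
Qed.

Lemma open_minimal : open (~` non_minimal).
Proof.
rewrite (_ : ~` non_minimal = \bigcup_n
    [set x | ~ (rank S N w0 < rank S N (suffix_word x n))%N]).
  apply: bigcup_open => n _.
  exact: (open_suffix_word (fun v => ~ (rank S N w0 < rank S N v)%N)).
apply/seteqP; split=> x /=; first by move=> /existsNP[n ?]; exists n.
by move=> [n _ xn] xb; exact/xn/xb.
Qed.

Lemma minimal_leftinf_of v : ~ non_minimal (leftinf_of (w0 ++ v)).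
Proof.
move=> /(_ (size (w0 ++ v))); rewrite suffix_word_leftinf_of.
by rewrite ltnNge rank_catl.
Qed.

Let regular := [set a : limit_space S |
  covering_number S R a = limit_measure S beta (tile S)].

Lemma covering_number_ge a :
  (limit_measure S beta (tile S) <= covering_number S R a)%E.
Proof.
have [x [g <-]] := limit_proj_surj a.
rewrite measure_tile (covering_number_proj nucN) lee_fin ler_nat.
exact: rank_min_le_stable.
Qed.

Lemma open_regular : open regular.
Proof.
rewrite /open /= /quotient_topology.quotient_open.
(* Openness in the quotient is openness of the preimage, which depends on the sequence only. *)
have -> : limit_proj S @^-1` regular =
    (@fst (leftinf X) (discrete_group G)) @^-1` (~` non_minimal).
  by apply/seteqP; split=> -[x g] xg; exact/(regular_proj x g).
apply: open_comp; last exact: open_minimal.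
by move=> [x g] _; exact: cvg_fst.
Qed.

Lemma dense_regular : dense regular.
Proof.
move=> U [a Ua] oU; have [x [g xg]] := limit_proj_surj a.
(* Writing [w0] to the left of ever longer suffixes of x gives sequences outside [non_minimal] that
   converge to x. *)
have ux : (fun n => (leftinf_of (w0 ++ suffix_word x n), g : discrete_group G))
    @ \oo --> (x, g : discrete_group G).
  have gg : (fun=> g : discrete_group G) @ \oo --> (g : discrete_group G).
    exact: cvg_cst.
  exact: (cvg_pair (@cvg_leftinf_of_cat X (fun=> w0) x) gg).
have : nbhs (x, g : discrete_group G) (limit_proj S @^-1` U).
  by apply: open_nbhs_nbhs; split; [exact: oU|rewrite /= xg].
move=> /ux[n _ /(_ n (leqnn n)) /= nU].
exists (limit_proj S (leftinf_of (w0 ++ suffix_word x n), g)); split=> //.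
by apply/regular_proj; exact: minimal_leftinf_of.
Qed.

Lemma measure_not_regular : limit_measure S beta (~` regular) = 0%E.
Proof.
rewrite limit_measureE; apply: integral0_eq => h _.
rewrite -non_minimal_null; congr (beta _).
apply/seteqP; split=> x /=.
  by move=> nr; apply: contrapT => /(regular_proj x h).
by move=> xb /regular_proj.
Qed.

End Conclusion.

Local Open Scope classical_set_scope.
Local Open Scope ereal_scope.

Theorem proposition12 (R : realType) (X : pfinType) (G : groupType)
    (S : selfsimilar_action X G) (beta : probability (leftinf X) R)
    (Scontr : contracting S) (beta_unif : uniform_bernoulli beta) :
  let mu := limit_measure S beta in
  let regular := [set a : limit_space S |
                   covering_number S R a = mu (tile S)] in
  [/\ forall a : limit_space S, mu (tile S) <= covering_number S R a,
      open regular,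
      dense regular
    & mu (~` regular) = 0].
Proof.
have [N nucN] := nucleus_exists Scontr.
have [w0 w0_min] := min_rank_exists S N.
split.
- exact: (covering_number_ge beta_unif nucN w0_min).
- exact: (open_regular beta_unif nucN w0_min).
- exact: (dense_regular beta_unif nucN w0_min).
- exact: (measure_not_regular beta_unif nucN w0_min).
Qed.
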